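(* Let $n\geqslant 2$. The complex Lie algebra $W_n$ of polynomial vector fields on $\mathbb{C}^n$ can be generated by two complete vector fields; that is, there exist complete vector fields $\delta, D\in W_n$ such that $W_n$ is generated by $\delta$ and $D$ as a Lie algebra over $\mathbb{C}$.
   Context: The ground field is $\mathbb{C}$. $W_n = \mathrm{Vec}(\mathbb{A}^n)$ is the complex Lie algebra of polynomial vector fields $f_1\partial_{x_1}+\ldots+f_n\partial_{x_n}$ on $\mathbb{C}^n$ with $f_1,\ldots,f_n\in\mathbb{C}[x_1,\ldots,x_n]$ (equivalently, all $\mathbb{C}$-derivations of $\mathbb{C}[x_1,\ldots,x_n]$), with the commutator bracket, i.e. $[f\partial_{x_i}, g\partial_{x_j}] = f\frac{\partial g}{\partial x_i}\partial_{x_j} - g\frac{\partial f}{\partial x_j}\partial_{x_i}$. A vector field $\delta\in W_n$ is complete if its flow map is well-defined for all complex times, i.e. for every $p\in\mathbb{C}^n$ there is a holomorphic map $\gamma:\mathbb{C}\to\mathbb{C}^n$ with $\gamma(0)=p$ and $\dot\gamma(s)$ equal to the value of $\delta$ at $\gamma(s)$ for all $s\in\mathbb{C}$. A subset $S$ generates a Lie algebra $\mathcal{L}$ if the smallest Lie subalgebra of $\mathcal{L}$ containing $S$ is $\mathcal{L}$. *)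

(* Defs.v *)
From HB Require Import structures.
From mathcomp Require Import all_boot all_order all_algebra.
From mathcomp Require Import classical_sets reals topology derive.
(* [normed_module] and [mpoly] declare incompatible notations. *)
From mathcomp Require Import -(notations) normedtype.
From mathcomp Require Import complex mpoly.

Set Implicit Arguments.
Unset Strict Implicit.
Unset Printing Implicit Defensive.

Import Order.TTheory GRing.Theory Num.Theory.
Import numFieldNormedType.Exports.

Local Open Scope classical_set_scope.
Local Open Scope ring_scope.

(* The polynomial vector field f_1 d/dx_1 + ... + f_n d/dx_n on C^n is encoded
   by its coefficients; the complex numbers are R[i] for R the real numbers. *)
Definition vfield (R : realType) (n : nat) : Type :=
  {ffun 'I_n -> {mpoly R[i][n]}}.

HB.instance Definition _ (R : realType) (n : nat) :=
  GRing.Lmodule.on (vfield R n).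

(* [f d_i, g d_j] = f (dg/dx_i) d_j - g (df/dx_j) d_i, extended bilinearly. *)
Definition bracket (R : realType) (n : nat) (X Y : vfield R n) : vfield R n :=
  [ffun j => \sum_(i < n) (X i * mderiv i (Y j) - Y i * mderiv i (X j))].

Definition lie_subalgebra (R : realType) (n : nat) (L : set (vfield R n)) :=
  [/\ L 0,
      forall X Y, L X -> L Y -> L (X + Y),
      forall (c : R[i]) X, L X -> L (c *: X) &
      forall X Y, L X -> L Y -> L (bracket X Y)].

Definition generates (R : realType) (n : nat) (S : set (vfield R n)) :=
  smallest (@lie_subalgebra R n) S = setT.

(* The scalars of the normed module [R[i]^o] are the complex numbers, so that
   [is_derive] expresses complex differentiability: an integral curve is
   required to be an entire map from C to C^n. *)
Definition complete (R : realType) (n : nat) (X : vfield R n) :=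
  forall p : 'I_n -> R[i],
  exists2 gamma : R[i]^o -> 'I_n -> R[i]^o,
    forall j, gamma 0 j = p j &
    forall (s : R[i]^o) (j : 'I_n),
      is_derive s (1 : R[i]^o) (gamma ^~ j) (X j).@[gamma s].

(* Main.v *)
Require Import Defs.
From mathcomp Require Import all_boot all_order all_algebra.
From mathcomp Require Import zify ring lra.
From mathcomp Require Import classical_sets reals topology sequences derive exp.
From mathcomp Require Import trigo.
From mathcomp Require Import -(notations) normedtype.
From mathcomp Require Import complex mpoly.

(** Two complete fields that generate W_n, for coordinates x_0, ..., x_(n-1).

    The first one is diagonal, delta = sum_i 4^i x_i d_i; its flow multiplies
    the coordinates by exponentials.

    The second one is D = l m d_v, where d_v is the derivative in the constant
    direction v = (n-1, 1, ..., 1) and, with r = x_1 + ... + x_(n-1),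
    l = 2 + x_0 - r and m = 1 + x_0 + r. Since d_v l = 0 and
    d_v m = 2(n-1), a trajectory of D stays on a line of direction v, on which
    l is a constant c while m satisfies the linear equation
    m' = 2(n-1) c m. Hence m is an exponential of time, the position is affine
    in m, and D is complete ([complete_overshear]).

    Let L be a Lie algebra that contains delta and D. The operator [ad delta]
    multiplies the monomial field x^b d_k by the weight
    sum_i 4^i b_i - 4^k, so a suitable product of operators
    [ad delta - c] kills all terms of D but those of one weight
    ([weight_isolate]). The coefficients of D have degree at most 2, and
    uniqueness of base 4 expansions shows that two of its terms x^b d_k and
    x^a d_j have the same weight only if b + e_j = a + e_k
    ([overshear_isolate]). As l m = 2 + 3 x_0 + r + x_0^2 - r^2, this puts
    into L
    - d_j, for all j;
    - x_i d_j, for all i <> j;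
    - x_0^2 d_0: the other fields of its weight are the x_0 x_k d_k, and the
      coefficient of x_0 x_k in l m is 0 for k > 0. This is the reason for
      the choice of l and m.

    The first two families have constant divergence, like the whole Lie algebra
    that they generate; the divergence of x_0^2 d_0 is not constant, and
    together these fields generate W_n ([lie_full]). To see this, call a
    polynomial f spread if f d_j lies in L for all j. The fields above yield
    gl_n, and bracketing with x_k d_i shows that spread polynomials are stable
    under f |-> x_k d_i f. So once x_0^d is spread, all monomials of degree d
    are. For d >= 2, the brackets
      [x_0^d d_0, x_0^2 d_j] = 2 x_0^(d+1) d_j for j <> 0,
      [x_0^2 d_1, x_0^(d-1) x_1 d_0] = x_0^(d+1) d_0 - 2 x_0^d x_1 d_1,
      [x_0^d d_0, x_0 x_1 d_1] = x_0^d x_1 d_1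
    show that x_0^(d+1) is spread as well.

    The complex exponential is built from the real exponential, sine and
    cosine, and differentiated by hand ([is_derive_cexp_affine]). *)

Set Implicit Arguments.
Unset Strict Implicit.
Unset Printing Implicit Defensive.

Import Order.TTheory GRing.Theory Num.Theory.
Import numFieldNormedType.Exports.

Local Open Scope classical_set_scope.
Local Open Scope ring_scope.
Local Open Scope complex_scope.

(* [Num.Theory] provides homonymous functions with values in R[i]. *)
Local Notation Re := complex.Re.
Local Notation Im := complex.Im.

(** * The complex exponential and its derivative *)

Section Deriv.
Variable K : numFieldType.

Lemma quotient_error_le (f : K^o -> K^o) (x df h e : K) : h != 0 ->
  (`|df - h^-1 *: ((f \o shift x) (h *: (1 : K^o)) - f x)| <= e) =
  (`|f (h + x) - f x - h * df| <= e * `|h|).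
Proof.
move=> h0; rewrite -ler_pdivrMr ?normr_gt0 // -normf_div -normrN opprB.
by rewrite /= /shift /= [h *: _]mulr1 mulrBl [h * df]mulrC mulfK //
  [_ / h]mulrC.
Qed.

(** This characterization of the derivative holds over R and over C alike; it
    transports the derivatives of exp, cos and sin from R to C. *)
Lemma is_derive_approxP (f : K^o -> K^o) (x df : K^o) :
  is_derive x (1 : K^o) f df <->
  forall e : K, 0 < e -> exists2 d : K, 0 < d &
    forall h : K, `|h| < d -> `|f (h + x) - f x - h * df| <= e * `|h|.
Proof.
split=> [[cv dv] e e0|H].
  have : h^-1 *: ((f \o shift x) (h *: (1 : K^o)) - f x) @[h --> 0^'] --> df.
    by rewrite -dv; exact: cv.
  move/(@cvgrPdist_le K K^o)/(_ e e0)/nbhs_ballP => [d /= d0 Hd].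
  exists d => // h hd.
  have [->|h0] := eqVneq h 0.
    by rewrite add0r subrr mul0r subr0 normr0 mulr0.
  have := Hd h; rewrite -ball_normE /= sub0r normrN => /(_ hd h0).
  by rewrite quotient_error_le.
have cv : h^-1 *: ((f \o shift x) (h *: (1 : K^o)) - f x) @[h --> 0^'] --> df.
  apply/(@cvgrPdist_le K K^o) => e e0.
  have [d d0 Hd] := H _ e0.
  near=> h.
  rewrite quotient_error_le; last by near: h; exact: nbhs_dnbhs_neq.
  by apply: Hd; near: h; exact: dnbhs0_lt.
split; last by apply: cvg_lim => //; exact: norm_hausdorff.
by apply/cvg_ex; exists df.
Unshelve. all: by end_near. Qed.

End Deriv.

Section Cexp.
Variable R : realType.

Definition cexp (z : R[i]) : R[i] :=
  (expR (Re z) * cos (Im z)) +i* (expR (Re z) * sin (Im z)).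

Lemma cexp0 : cexp 0 = 1.
Proof. by rewrite /cexp /= expR0 cos0 sin0 mulr1 mulr0. Qed.

Lemma cexpD (z w : R[i]) : cexp (z + w) = cexp z * cexp w.
Proof.
case: z w => [a b] [c d]; rewrite /cexp /=.
rewrite expRD cosD sinD; apply/eqP; rewrite eq_complex /=.
by apply/andP; split; apply/eqP; ring.
Qed.

Lemma normc_leD (z : R[i]) : `|z| <= (`|Re z| + `|Im z|)%:C.
Proof.
rewrite [in X in X <= _](complexE z) (le_trans (ler_normD _ _)) //.
rewrite normrM rmorphD /=.
by rewrite !normc_def /= !expr0n /= !addr0 !add0r !expr1n sqrtr1 mul1r
  !sqrtr_sqr.
Qed.

Lemma normc_ge_Im (z : R[i]) : `|Im z|%:C <= `|z|.
Proof.
by rewrite normc_def lecR -sqrtr_sqr ler_sqrt ?lerDr ?sqr_ge0 // addr_ge0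
  ?sqr_ge0.
Qed.

(** exp is complex differentiable at 0: with h = a + ib,
    e^a cos b - 1 - a = e^a (cos b - 1) + (e^a - 1 - a) and
    e^a sin b - b = e^a (sin b - b) + (e^a - 1) b, where every summand is
    o(|h|) because of the derivatives at 0 of the real functions. *)
Lemma cexp_approx (e : R[i]) : 0 < e -> exists2 d : R[i], 0 < d &
  forall h : R[i], `|h| < d -> `|cexp h - 1 - h| <= e * `|h|.
Proof.
case: e => e1 e2 /=; rewrite ltcE /= => /andP[/eqP -> e0].
(* The real and imaginary parts of exp h - 1 - h, for h = a + ib, add up to at
   most 7 t |h| when the real functions are approximated to precision t. *)
pose t := Num.min (e1 / 7) (1/2).
have t0 : 0 < t by rewrite /t lt_min; apply/andP; split; lra.
have t1 : t <= 1/2 by rewrite /t ge_min lexx orbT.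
have te : 7 * t <= e1 by have : t <= e1/7 by [rewrite /t ge_min lexx]; lra.
clearbody t.
have [d1 d10 H1] :=
  (@is_derive_approxP R _ _ _).1 (is_derive_expR (0 : R)) _ t0.
have [d2 d20 H2] :=
  (@is_derive_approxP R _ _ _).1 (is_derive_sin (0 : R)) _ t0.
have [d3 d30 H3] :=
  (@is_derive_approxP R _ _ _).1 (is_derive_cos (0 : R)) _ t0.
exists (Num.min t (Num.min d1 (Num.min d2 d3)))%:C.
  by rewrite ltcR !lt_min t0 d10 d20 d30.
move=> h; rewrite -[`|h|]RRe_real ?normr_real // ltcR !lt_min.
set r := Re `|h| => /and4P[rt r1 r2 r3].
apply: le_trans (normc_leD _) _.
rewrite -[e1 +i* 0]/(e1%:C) -rmorphM /= lecR.
have ha : `|Re h| <= r.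
  by rewrite -lecR [r%:C]RRe_real ?normr_real // normc_ge_Re.
have hb : `|Im h| <= r.
  by rewrite -lecR [r%:C]RRe_real ?normr_real // normc_ge_Im.
case: h @r rt r1 r2 r3 ha hb => a b r rt r1 r2 r3 /= ha hb.
have {}H1 := H1 a (le_lt_trans ha r1).
have {}H2 := H2 b (le_lt_trans hb r2).
have {}H3 := H3 b (le_lt_trans hb r3).
move: H1 H2 H3; rewrite !addr0 expR0 sin0 cos0 mulr1 oppr0 mulr0 !subr0 mulr1.
move: (expR a) (cos b) (sin b) => E C S H1 H2 H3.
rewrite !addr0 in H2 *.
have -> : E * C - 1 - a = E * (C - 1) + (E - 1 - a) by ring.
have -> : E * S - b = E * (S - b) + (E - 1) * b by ring.
have ta : t * `|a| <= t * r by rewrite ler_pM2l.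
have tb : t * `|b| <= t * r by rewrite ler_pM2l.
have r0 : 0 <= r by exact: le_trans ha.
have E1 : `|E - 1| <= 2 * r.
  have -> : E - 1 = (E - 1 - a) + a by ring.
  apply: le_trans (ler_normD _ _) _; nra.
have E2 : `|E| <= 2.
  have -> : E = (E - 1) + 1 by ring.
  apply: le_trans (ler_normD _ _) _; rewrite normr1; nra.
have k1 : `|E * (C - 1)| <= 2 * (t * r).
  rewrite normrM; apply: ler_pM => //; exact: le_trans H3 tb.
have k2 : `|E * (S - b)| <= 2 * (t * r).
  rewrite normrM; apply: ler_pM => //; exact: le_trans H2 tb.
have k3 : `|(E - 1) * b| <= 2 * r * r by rewrite normrM; apply: ler_pM.
have := ler_normD (E * (C - 1)) (E - 1 - a).
have := ler_normD (E * (S - b)) ((E - 1) * b).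
nra.
Qed.

(** The functional equation carries the derivative from 0 to any point. All
    integral curves used below have coordinates of this form. *)
Lemma is_derive_cexp_affine (A B c s : R[i]) :
  is_derive (s : R[i]^o) (1 : R[i]^o)
    (fun z : R[i]^o => A + B * cexp (c * z) : R[i]^o)
    (c * (B * cexp (c * s)) : R[i]^o).
Proof.
apply/is_derive_approxP => e e0.
pose k := `|B * cexp (c * s)| * `|c| + 1.
have k0 : 0 < k by rewrite /k ltr_pwDr // mulr_ge0.
have [d d0 Hd] := cexp_approx (divr_gt0 e0 k0).
have c0 : 0 < `|c| + 1 by rewrite ltr_pwDr.
exists (d / (`|c| + 1)); first exact: divr_gt0.
move=> h; rewrite ltr_pdivlMr // => hd.
have chd : `|c * h| < d.
  by apply: le_lt_trans hd; rewrite normrM mulrC ler_wpM2l // lerDl.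
have -> : A + B * cexp (c * (h + s)) - (A + B * cexp (c * s))
    - h * (c * (B * cexp (c * s)))
  = B * cexp (c * s) * (cexp (c * h) - 1 - c * h).
  rewrite mulrDr cexpD; ring.
rewrite normrM.
apply: le_trans (ler_wpM2l (normr_ge0 _) (Hd _ chd)) _.
rewrite (normrM c).
have -> : `|B * cexp (c * s)| * (e / k * (`|c| * `|h|))
  = (k - 1) / k * (e * `|h|) by rewrite /k; field; apply: lt0r_neq0.
apply: ler_piMl; first by rewrite mulr_ge0 // ltW.
by rewrite ler_pdivrMr // mul1r lerBlDr lerDl.
Qed.

End Cexp.

(** * Weights of a diagonal vector field *)

Section Fields.
Variables (R : realType) (n : nat).
Local Notation C := R[i].

Definition diagonal_field (w : 'I_n -> nat) : vfield R n :=
  [ffun i => (w i)%:R *: 'X_i].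

Lemma complete_diagonal_field w : complete (diagonal_field w).
Proof.
move=> p; exists (fun s j => 0 + p j * cexp ((w j)%:R * s)) => [j|s j].
  by rewrite mulr0 cexp0 mulr1 add0r.
rewrite ffunE mevalZ mevalXU add0r.
have := is_derive_cexp_affine 0 (p j) (w j)%:R s.
by [].
Qed.

Definition coord_field (f : {mpoly C[n]}) (j : 'I_n) : vfield R n :=
  [ffun k => if k == j then f else 0].

Lemma bracket_coord_field f g i j :
  bracket (coord_field f i) (coord_field g j) =
  coord_field (f * mderiv i g) j - coord_field (g * mderiv j f) i.
Proof.
apply/ffunP => k; rewrite !ffunE.
under eq_bigr => l _ do rewrite !ffunE.
rewrite sumrB; congr (_ - _).
  rewrite (bigD1 i) //= eqxx big1 => [|l /negPf ->]; last by rewrite mul0r.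
  by case: eqP => _; rewrite addr0 // mderiv0 mulr0.
rewrite (bigD1 j) //= eqxx big1 => [|l /negPf ->]; last by rewrite mul0r.
by case: eqP => _; rewrite addr0 // mderiv0 mulr0.
Qed.

Lemma coord_field_sum (X : vfield R n) : X = \sum_j coord_field (X j) j.
Proof.
apply/ffunP => k; rewrite sum_ffunE (bigD1 k) //= ffunE eqxx big1 ?addr0 //.
by move=> j; rewrite ffunE eq_sym => /negPf ->.
Qed.

(** x_i d/dx_i is diagonal in the monomial basis. *)
Lemma mcoeff_euler (p : {mpoly C[n]}) i m :
  ('X_i * mderiv i p)@_m = p@_m * (m i)%:R.
Proof.
rewrite {1}[p]mpolyE (raddf_sum (mderiv i)) /= mulr_sumr raddf_sum /=.
rewrite [in RHS](mpolyE p) raddf_sum /= mulr_suml; apply: eq_bigr => k _.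
rewrite mderivZ mderivX -!scalerAr !mcoeffZ -mpolyXD -mulrA; congr (_ * _).
have [k0|k0] := eqVneq (k i) 0%N.
  rewrite k0 mul0r mcoeffX.
  by have [<-|] := eqVneq k m; rewrite ?k0 ?mulr0 ?mul0r.
rewrite addmC submK ?lep1mP // !mcoeffX.
by have [<-|] := eqVneq k m; rewrite ?mulr0 ?mul0r // mulr1 mul1r.
Qed.

(** The eigenvalue of [bracket (diagonal_field w)] on x^b d_k. *)
Definition weight (w : 'I_n -> nat) (k : 'I_n) (b : 'X_{1..n}) : C :=
  (\sum_i w i * b i)%:R - (w k)%:R.

Lemma mcoeff_bracket_diagonal w (X : vfield R n) k b :
  (bracket (diagonal_field w) X k)@_b = weight w k b * (X k)@_b.
Proof.
rewrite /bracket ffunE raddf_sum /=.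
under eq_bigr => i _.
  rewrite !ffunE mcoeffB mderivZ -scalerAl mcoeffZ mcoeff_euler mderivX.
  rewrite mnm1E -!scalerAr !mcoeffZ.
  over.
rewrite sumrB /weight mulrBl; congr (_ - _).
  rewrite natr_sum mulr_suml; apply: eq_bigr => i _.
  by rewrite natrM -mulrA; congr (_ * _); rewrite mulrC.
rewrite (bigD1 k) //= eqxx big1 ?addr0; last first.
  by move=> i; rewrite eq_sym => /negPf ->; rewrite mul0r mulr0.
rewrite mul1r; congr (_ * _).
suff -> : (U_(k) - U_(k) = 0 :> 'X_{1..n})%MM by rewrite mpolyX0 mulr1.
by apply/mnmP => i; rewrite mnmBE subnn mnm0E.
Qed.

Section Sub.
Variable L : set (vfield R n).
Hypothesis LL : lie_subalgebra L.

Lemma lieD X Y : L X -> L Y -> L (X + Y).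
Proof. by case: LL => _ + _ _; apply. Qed.
Lemma lieZ (c : C) X : L X -> L (c *: X).
Proof. by case: LL => _ _ + _; apply. Qed.
Lemma lieB X Y : L X -> L Y -> L (X - Y).
Proof. by move=> HX HY; apply: lieD => //; rewrite -scaleN1r; apply: lieZ. Qed.
Lemma lieZK (c : C) X : c != 0 -> L (c *: X) -> L X.
Proof. by move=> c0 /(lieZ c^-1); rewrite scalerA mulVf // scale1r. Qed.
Lemma lie_bracket X Y : L X -> L Y -> L (bracket X Y).
Proof. by case: LL => _ _ _; apply. Qed.
Lemma lie_sum (I : Type) (r : seq I) (P : pred I) (F : I -> vfield R n) :
  (forall i, P i -> L (F i)) -> L (\sum_(i <- r | P i) F i).
Proof. move=> H; elim/big_ind: _ => //; [by case: LL | exact: lieD]. Qed.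

(** Y is obtained from X by composing the operators [ad delta - c] for the c
    in s. *)
Lemma weight_product w X (s : seq C) : L (diagonal_field w) -> L X ->
  exists2 Y : vfield R n, L Y &
    forall k b, (Y k)@_b = (X k)@_b * \prod_(c <- s) (weight w k b - c).
Proof.
move=> Lw LX; elim: s => [|c s [Y LY HY]].
  by exists X => // k b; rewrite big_nil mulr1.
exists (bracket (diagonal_field w) Y - c *: Y).
  by apply: lieB; [exact: lie_bracket|exact: lieZ].
move=> k b; have -> : forall A B : vfield R n, (A - c *: B) k = A k - c *: B k.
  by move=> A B; rewrite !ffunE.
rewrite big_cons mcoeffB mcoeff_bracket_diagonal mcoeffZ HY; ring.
Qed.

(** With all the other weights of X for s in [weight_product], x^a d_j is the
    only term of X that is left. *)
Lemma weight_isolate w X j a : L (diagonal_field w) -> L X ->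
  (forall k b, (X k)@_b != 0 -> weight w k b = weight w j a ->
    k = j /\ b = a) ->
  (X j)@_a != 0 -> L (coord_field 'X_[a] j).
Proof.
move=> Lw LX sep nz.
pose s := [seq c <- [seq weight w k b | k <- enum 'I_n, b <- msupp (X k)]
  | c != weight w j a].
have [Y LY HY] := weight_product s Lw LX.
pose c := (X j)@_a * \prod_(c <- s) (weight w j a - c).
have c0 : c != 0.
  rewrite mulf_neq0 // prodf_seq_neq0.
  apply/allP => d; rewrite mem_filter => /andP[dn _].
  by rewrite subr_eq0 eq_sym.
apply: (@lieZK c) => //; suff <- : Y = c *: coord_field 'X_[a] j by [].
apply/ffunP => k; apply/mpolyP => b; rewrite HY !ffunE mcoeffZ.
have [Xz|Xn] := eqVneq ((X k)@_b) 0.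
  rewrite Xz mul0r; have [kj|_] := eqVneq k j; last by rewrite mcoeff0 mulr0.
  rewrite mcoeffX; have [ab|_] := eqVneq a b; last by rewrite mulr0.
  by move: nz; rewrite ab -kj Xz eqxx.
have [Wk|Wk] := eqVneq (weight w k b) (weight w j a).
  have [-> ->] := sep _ _ Xn Wk.
  by rewrite eqxx mcoeffX eqxx mulr1.
have -> : \prod_(d <- s) (weight w k b - d) = 0.
  apply/eqP; rewrite prodf_seq_eq0; apply/hasP; exists (weight w k b);
    last by rewrite subrr eqxx.
  rewrite mem_filter Wk; apply/allpairsPdep; exists k, b.
  by rewrite mem_enum mcoeff_msupp.
rewrite mulr0; have [kj|_] := eqVneq k j; last by rewrite mcoeff0 mulr0.
rewrite mcoeffX; have [ab|_] := eqVneq a b; last by rewrite mulr0.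
by move: Wk; rewrite kj ab eqxx.
Qed.

End Sub.
End Fields.

(** * From gl_n and one quadratic field to all polynomial fields *)

Section Gen.
Variables (R : realType) (n : nat).
Local Notation C := R[i].
Variable L : set (vfield R n).
Hypothesis LL : lie_subalgebra L.

Lemma mderiv_var i j : mderiv i ('X_j : {mpoly C[n]}) = (i == j)%:R.
Proof.
rewrite mderivX mnm1E eq_sym; case: eqP => [->|_]; last by rewrite scale0r.
rewrite scale1r.
suff -> : (U_(j) - U_(j) = 0 :> 'X_{1..n})%MM by rewrite mpolyX0.
by apply/mnmP => k; rewrite mnmBE subnn mnm0E.
Qed.

Lemma mderiv_var_exp i j d :
  mderiv i ('X_j ^+ d.+1 : {mpoly C[n]}) = (i == j)%:R * d.+1%:R * 'X_j ^+ d.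
Proof.
elim: d => [|d IH]; first by rewrite expr1 mderiv_var expr0 !mulr1.
rewrite exprS mderivM IH mderiv_var exprS -[in RHS]natr1; ring.
Qed.

Definition spread (f : {mpoly C[n]}) := forall j, L (coord_field f j).

Lemma coord_fieldZ (c : C) f (j : 'I_n) :
  coord_field (c *: f) j = c *: coord_field f j.
Proof.
by apply/ffunP => k; rewrite !ffunE; case: eqP => // _; rewrite scaler0.
Qed.

Lemma coord_fieldD f g (j : 'I_n) :
  coord_field (f + g) j = coord_field f j + coord_field g j :> vfield R n.
Proof.
by apply/ffunP => k; rewrite !ffunE; case: eqP => // _; rewrite addr0.
Qed.

Lemma coord_field0 (j : 'I_n) : coord_field 0 j = 0 :> vfield R n.
Proof. by apply/ffunP => k; rewrite !ffunE; case: eqP. Qed.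

Lemma lie0 : L 0. Proof. by case: LL. Qed.

Lemma coord_bracket f g i j : L (coord_field f i) -> L (coord_field g j) ->
  L (coord_field (f * mderiv i g) j - coord_field (g * mderiv j f) i).
Proof. by rewrite -bracket_coord_field; exact: lie_bracket. Qed.

Lemma spread_scale (c : C) f : c != 0 -> spread (c *: f) -> spread f.
Proof. by move=> c0 H j; have := H j; rewrite coord_fieldZ; apply: lieZK. Qed.

Variables o o' : 'I_n.
Hypothesis oo' : o' != o.
Hypothesis L1 : forall j, L (coord_field 1 j).
Hypothesis Lx : forall i j, i != j -> L (coord_field 'X_i j).
Hypothesis Lo2 : L (coord_field ('X_o ^+ 2) o).

Lemma spread_var i : spread 'X_i.
Proof.
(* The diagonal part of gl_n: x_o d_o comes from [d_o, x_o^2 d_o], and the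
   other x_i d_i from [x_o d_i, x_i d_o] = x_o d_o - x_i d_i. *)
have Lo : L (coord_field 'X_o o).
  have := coord_bracket (L1 o) Lo2.
  rewrite mderiv_var_exp -(mpolyC1 n R[i]) mderivC mulr0 coord_field0 subr0
    eqxx !mul1r expr1.
  rewrite -mpolyC_nat mul_mpolyC coord_fieldZ; apply: lieZK => //.
  by rewrite pnatr_eq0.
move=> j; have [<-|ij] := eqVneq i j; last exact: Lx.
have [->//|io] := eqVneq i o.
have oi : o != i by rewrite eq_sym.
have := coord_bracket (Lx oi) (Lx io).
rewrite !mderiv_var !eqxx !mulr1 => H.
rewrite -[X in L X](subKr (coord_field 'X_o o)); exact: lieB.
Qed.

(** Bracketing with x_k d_i also produces - (d_j x_k) f d_i, which lies in L
    because f is spread: this is why all the directions are considered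
    together. *)
Lemma spread_shift f i k : spread f -> spread ('X_k * mderiv i f).
Proof.
move=> Hf j; have := coord_bracket (spread_var k i) (Hf j).
rewrite mderiv_var; case: eqP => _ H; last first.
  by move: H; rewrite mulr0 coord_field0 subr0.
rewrite -[X in L X](subrK (coord_field f i)).
by apply: lieD => //; move: H; rewrite mulr1.
Qed.

(** The induction step from x_o^d to x_o^(d+1). In direction o, it combines
    [x_o^2 d_o', x_o^(d-1) x_o' d_o] and [x_o^d d_o, x_o x_o' d_o'] so as to
    cancel the multiples of x_o^d x_o' d_o'. *)
Lemma spread_var_exp d : spread ('X_o ^+ d.+2).
Proof.
have spread2 : spread ('X_o ^+ 2).
  move=> j; have [->//|jo] := eqVneq j o.
  have := coord_bracket Lo2 (spread_var o j).
  by rewrite mderiv_var mderiv_var_exp eqxx (negPf jo) mulr1 !mul0r mulr0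
    coord_field0 subr0.
have spread11 : spread ('X_o * 'X_o').
  apply: (@spread_scale 2); first by rewrite pnatr_eq0.
  have -> : 2 *: ('X_o * 'X_o') = 'X_o' * mderiv o ('X_o ^+ 2) :> {mpoly C[n]}.
    rewrite mderiv_var_exp eqxx mul1r -mul_mpolyC mpolyC_nat expr1; ring.
  exact: spread_shift.
elim: d => [//|d IH] j.
have [->|jo] := eqVneq j o; last first.
  have := coord_bracket (IH o) (spread2 j).
  rewrite !mderiv_var_exp eqxx (negPf jo) !mul0r mulr0 coord_field0 subr0.
  have -> : 'X_o ^+ d.+2 * (1 * 2 * 'X_o ^+ 1) = 2 *: 'X_o ^+ d.+3
    :> {mpoly C[n]}.
    rewrite -mul_mpolyC mpolyC_nat [in RHS]exprS expr1; ring.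
  by rewrite coord_fieldZ; apply: lieZK => //; rewrite pnatr_eq0.
have spread_d1 : spread ('X_o ^+ d.+1 * 'X_o').
  apply: (@spread_scale d.+2%:R); first by rewrite pnatr_eq0.
  have -> : d.+2%:R *: ('X_o ^+ d.+1 * 'X_o') =
    'X_o' * mderiv o ('X_o ^+ d.+2) :> {mpoly C[n]}.
    rewrite mderiv_var_exp eqxx mul1r -mul_mpolyC mpolyC_nat; ring.
  exact: spread_shift.
have A := coord_bracket (spread2 o') (spread_d1 o).
have B := coord_bracket (IH o) (spread11 o').
have E := lieD LL A (lieZ LL 2 B); move: E.
rewrite !mderivM !mderiv_var_exp !mderiv_var !eqxx (negPf oo') (eq_sym o)
  (negPf oo').
rewrite !(mulr0n, mulr1n, mul0r, mulr0, mul1r, mulr1, add0r, addr0).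
rewrite coord_field0 subr0 -coord_fieldZ.
set f := 'X_o ^+ 2 * _; set g := _ * ('X_o + _); set h := 2 *: _.
have -> : h = g.
  rewrite /h /g -mul_mpolyC mpolyC_nat exprS; ring.
by rewrite subrK /f -exprD.
Qed.

(** Up to a nonzero factor, any monomial is obtained from a power of x_o by
    operators x_k d/dx_o with k != o; the induction is on the degree in the
    variables other than x_o. *)
Lemma spread_monomial m : spread 'X_[m].
Proof.
have [c] : exists c, mdeg m = (m o + c)%N.
  by exists (mdeg m - m o)%N; rewrite subnKC // mdegE (bigD1 o) //= leq_addr.
elim: c m => [|c IH] m Hm.
  have -> : m = (U_(o) *+ (m o))%MM.
    apply/mnmP => i; rewrite mulmnE mnm1E; have [<-|io] := eqVneq o i.
      by rewrite mul1n.
    move/eqP: Hm; rewrite addn0 mdegE (bigD1 o) //= -[X in _ == X]addn0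
      eqn_add2l.
    by rewrite sum_nat_eq0 => /forallP/(_ i); rewrite eq_sym io => /eqP.
  rewrite -mpolyXn; case: (m o) => [|[|d]]; first by rewrite expr0.
    by rewrite expr1; exact: spread_var.
  exact: spread_var_exp.
have [k ko mk] : exists2 k, k != o & (0 < m k)%N.
  have : (0 < \sum_(i | i != o) m i)%N.
    by move/eqP: Hm; rewrite mdegE (bigD1 o) //= eqn_add2l => /eqP ->.
  rewrite lt0n sum_nat_eq0 negb_forall => /existsP[k].
  by rewrite negb_imply => /andP[ko mk]; exists k => //; rewrite lt0n.
pose m' := (m - U_(k) + U_(o))%MM.
have m'o : m' o = (m o).+1.
  by rewrite mnmDE mnmBE !mnm1E eqxx (negPf ko) subn0 addn1.
have Hk : (U_(k) <= m)%MM by rewrite lep1mP -lt0n.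
have m'd : mdeg m' = (m' o + c)%N.
  rewrite m'o addSnnS -Hm mdegD mdeg1 -(mdeg1 k) -mdegD submK //.
apply: (@spread_scale (m o).+1%:R); first by rewrite pnatr_eq0.
suff -> : (m o).+1%:R *: 'X_[m] = 'X_k * mderiv o 'X_[m'] :> {mpoly C[n]}.
  exact/spread_shift/IH.
rewrite mderivX m'o -scalerAr -mpolyXD; congr (_ *: 'X_[_]).
by rewrite /m' addmK addmC submK.
Qed.

Lemma lie_full X : L X.
Proof.
rewrite (coord_field_sum X); apply: (lie_sum LL) => j _.
rewrite [X j]mpolyE; elim/big_ind: _ => [|f g Lf Lg|m _].
- by rewrite coord_field0; exact: lie0.
- by rewrite coord_fieldD; exact: lieD.
- by rewrite coord_fieldZ; apply: lieZ => //; exact: spread_monomial.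
Qed.

End Gen.

(** * The two generators *)

Lemma base_expansion_inj n (f g : 'I_n -> nat) B :
  (forall i, (f i < B)%N) -> (forall i, (g i < B)%N) ->
  (\sum_(i < n) B ^ i * f i = \sum_(i < n) B ^ i * g i)%N -> f =1 g.
Proof.
elim: n f g => [|n IH] f g fB gB; first by move=> _ [].
rewrite !big_ord_recl /= !expn0 !mul1n.
under eq_bigr => i _ do rewrite expnS -mulnA.
under [in X in _ = X -> _]eq_bigr => i _ do rewrite expnS -mulnA.
rewrite -!big_distrr /= => H.
have B0 : (0 < B)%N by exact: leq_ltn_trans (fB ord0).
have H0 : f ord0 = g ord0.
  have := congr1 (fun t => t %% B)%N H.
  by rewrite -modnDmr modnMr addn0 -[in RHS]modnDmr modnMr addn0 !modn_small.
move/eqP: H; rewrite H0 eqn_add2l eqn_pmul2l // => /eqP H.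
have Hl : f \o lift ord0 =1 g \o lift ord0.
  by apply: IH H => i /=; [exact: fB|exact: gB].
move=> i; case: (unliftP ord0 i) => [j ->|->//]; exact: Hl.
Qed.

Section Main.
Variables (R : realType) (n : nat).
Local Notation C := R[i].
Local Notation N := n.+2.
Local Notation o := (ord0 : 'I_N).

Definition tail_sum : {mpoly C[N]} := \sum_(i < n.+1) 'X_(lift ord0 i).
Definition quad : {mpoly C[N]} := (2 + 'X_o - tail_sum) * (1 + 'X_o + tail_sum).

(** The vector v: its first coordinate balances the sum of the others, so that
    x_0 - tail_sum is constant in direction v. *)
Definition dir (j : 'I_N) : C := if j == o then n.+1%:R else 1.

Definition overshear : vfield R N := [ffun j => dir j *: quad].

Lemma meval_tail_sum v : tail_sum.@[v] = \sum_(i < n.+1) v (lift ord0 i).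
Proof.
by rewrite /tail_sum raddf_sum; apply: eq_bigr => i _; rewrite /= mevalXU.
Qed.

Lemma meval_quad v : quad.@[v] =
  (2 + v o - \sum_(i < n.+1) v (lift ord0 i)) *
  (1 + v o + \sum_(i < n.+1) v (lift ord0 i)).
Proof.
rewrite /quad mevalM mevalB !mevalD meval1 mevalXU.
by rewrite meval_tail_sum.
Qed.

(** Along the trajectory from p, the factor 2 + x_0 - tail_sum is constant, the
    factor 1 + x_0 + tail_sum equals k u0 exp(g s), and the position is affine
    in the latter. *)
Lemma complete_overshear : complete overshear.
Proof.
move=> p.
pose r0 := \sum_(i < n.+1) p (lift ord0 i).
pose k : C := 2 * n.+1%:R.
pose u0 := (1 + p o + r0) / k.
pose g := k * (2 + p o - r0).
have n0 : n.+1%:R != 0 :> C by rewrite pnatr_eq0.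
have k0 : k != 0 by rewrite mulf_neq0 // pnatr_eq0.
pose z (s : C) j : C := (p j - dir j * u0) + (dir j * u0) * cexp (g * s).
exists z => [j|s j].
  by rewrite /z mulr0 cexp0 mulr1 subrK.
suff -> : (overshear j).@[z s] = g * (dir j * u0 * cexp (g * s)).
  exact: is_derive_cexp_affine.
rewrite ffunE mevalZ meval_quad.
have -> : \sum_(i < n.+1) z s (lift ord0 i) =
  r0 + n.+1%:R * (u0 * (cexp (g * s) - 1)).
  rewrite mulr_natl -[in RHS](card_ord n.+1) -sumr_const -big_split /=.
  by apply: eq_bigr => i _; rewrite /z /dir /=; ring.
rewrite /z /(dir ord0) eqxx.
move: (cexp _) => E.
have -> : 1 + (p o - n.+1%:R * u0 + n.+1%:R * u0 * E)
    + (r0 + n.+1%:R * (u0 * (E - 1))) = k * (u0 * E).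
  transitivity (1 + p o + r0 + k * (u0 * (E - 1))); first by rewrite /k; ring.
  have -> : 1 + p o + r0 = k * u0 by rewrite /u0 mulrC divfK.
  ring.
rewrite /g; clearbody k u0 r0; clear z g; ring.
Qed.

Lemma mderiv_tail_sum i : mderiv i tail_sum = (i != o)%:R.
Proof.
rewrite /tail_sum (raddf_sum (mderiv i)) /=.
under eq_bigr => j _ do rewrite mderiv_var.
case: (unliftP o i) => [j ->|->]; last by rewrite big1.
rewrite (bigD1 j) //= eqxx big1 ?addr0 // => l lj.
by rewrite (inj_eq lift_inj) eq_sym (negPf lj).
Qed.

(** The coefficients of quad of degrees 1 and 2 that matter are constant and
    linear coefficients of these derivatives. *)
Lemma mderiv_quad i :
  mderiv i quad = if i == o then 3 + 2 * 'X_o else 1 - 2 * tail_sum.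
Proof.
rewrite /quad mderivM mderivB !mderivD !mderiv_var mderiv_tail_sum.
rewrite -(mpolyC1 N C) !mderivC mpolyC1.
case: eqP => _ /=; rewrite ?mulr0n ?mulr1n; ring.
Qed.

Lemma mcoeff0_var i : ('X_i : {mpoly C[N]})@_0 = 0.
Proof. by rewrite mcoeffX mnm1_eq0. Qed.

Lemma mcoeff0_tail_sum : tail_sum@_0 = 0.
Proof. by rewrite raddf_sum big1 // => i _; exact: mcoeff0_var. Qed.

Lemma quad_coeff0 : quad@_0 = 2.
Proof.
rewrite /quad rmorphM /= mcoeffB !mcoeffD mcoeff0_var mcoeff0_tail_sum.
rewrite !mcoeff1 eqxx mulr1n; ring.
Qed.

Lemma quad_coeff1 k : quad@_U_(k) != 0.
Proof.
have := mcoeff_mderiv k quad 0%MM; rewrite add0m mnm0E mulr1n => <-.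
rewrite mderiv_quad; case: ifP => _.
  rewrite mcoeffD rmorphM /= mcoeff0_var mulr0 addr0 -mpolyC_nat mcoeffC eqxx
    mulr1.
  by rewrite pnatr_eq0.
by rewrite mcoeffB rmorphM /= mcoeff0_tail_sum mulr0 subr0 mcoeff1 eqxx
  oner_eq0.
Qed.

(** The product of the two factors of quad contains no x_0 x_k with k > 0,
    since its quadratic part is x_0^2 - tail_sum^2. *)
Lemma quad_coeff2 k : (quad@_(U_(k) + U_(o)) != 0) = (k == o).
Proof.
have := mcoeff_mderiv o quad U_(k)%MM.
rewrite mderiv_quad eqxx -!mpolyC_nat mcoeffD mul_mpolyC mcoeffZ mcoeffC
  mcoeffXU.
rewrite mnm1_eq0 mulr0 add0r (eq_sym o) => /(congr1 (eq_op^~ 0)) /=.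
rewrite mulrn_eq0 mulf_eq0 !pnatr_eq0 /= => <-.
by case: (k == o).
Qed.

Lemma quad_mdeg b : quad@_b != 0 -> (mdeg b <= 2)%N.
Proof.
move=> nz; have : (mdeg b < msize quad)%N.
  by apply: msize_mdeg_lt; rewrite mcoeff_msupp.
have : quad != 0 by apply: contraNneq nz => ->; rewrite mcoeff0.
rewrite /quad mulf_eq0 negb_or => /andP[q1 q2]; rewrite msizeM //.
have lin (p : {mpoly C[N]}) (e : C) : (msize p <= 2)%N ->
  (msize (e%:MP + 'X_o + p) <= 2)%N.
  move=> Hp; apply: leq_trans (msizeD_le _ _) _; rewrite geq_max Hp andbT.
  apply: leq_trans (msizeD_le _ _) _; rewrite geq_max msizeX mdeg1 andbT.
  by rewrite msizeC; case: (_ != _).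
have st : (msize tail_sum <= 2)%N.
  rewrite /tail_sum; elim/big_ind: _ => [|p q Hp Hq|i _].
  - by rewrite msize0.
  - by apply: leq_trans (msizeD_le _ _) _; rewrite geq_max Hp Hq.
  - by rewrite msizeX mdeg1.
have H1 := lin tail_sum 1 st.
have H2 := lin (- tail_sum) 2; rewrite msizeN mpolyC_nat in H2.
move: (H2 st); rewrite mpolyC1 in H1; move: H1.
move: (msize _) (msize _) => s1 s2; lia.
Qed.

(** The weights 4^i separate the terms of the overshear up to b + e_j = a + e_k,
    since both sides have exponents at most 3. *)
Lemma overshear_isolate (L : set (vfield R N)) j a :
  lie_subalgebra L ->
  L (diagonal_field R (fun i : 'I_N => 4 ^ i)%N) -> L overshear ->
  (forall k b, quad@_b != 0 -> (b + U_(j) = a + U_(k))%MM -> k = j) ->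
  quad@_a != 0 -> L (coord_field 'X_[a] j).
Proof.
move=> LL Lg Ls sep nz.
have dn k : dir k != 0 by rewrite /dir; case: ifP; rewrite ?pnatr_eq0 ?oner_eq0.
apply: (weight_isolate LL Lg Ls); last by rewrite ffunE mcoeffZ mulf_neq0.
move=> k b; rewrite ffunE mcoeffZ mulf_eq0 negb_or dn /= => nzb W.
suff E : (b + U_(j) = a + U_(k))%MM.
  have kj := sep _ _ nzb E; split=> //.
  by move: E; rewrite kj => /addIm.
have le4 (c : 'X_{1..N}) l i : quad@_c != 0 -> ((c + U_(l))%MM i < 4)%N.
  move=> /quad_mdeg; rewrite mnmDE mnm1E mdegE (bigD1 i) //=.
  by case: (l == i); lia.
apply/mnmP; apply: (@base_expansion_inj _ _ _ 4); [by move=> i; exact: le4..|].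
have S (c : 'X_{1..N}) l :
  (\sum_(i < N) 4 ^ i * (c + U_(l))%MM i =
   \sum_(i < N) 4 ^ i * c i + 4 ^ l)%N.
  under eq_bigr => i _ do rewrite mnmDE mulnDr mnm1E.
  rewrite big_split /=; congr (_ + _)%N.
  rewrite (bigD1 l) //= eqxx muln1 big1 ?addn0 // => i.
  by rewrite eq_sym => /negPf ->; rewrite muln0.
rewrite !S; apply/eqP; rewrite -(@eqr_nat C) !natrD; apply/eqP.
by move/eqP: W; rewrite /weight subr_eq addrAC eq_sym subr_eq => /eqP.
Qed.

End Main.

Theorem corollary2 (R : realType) (n : nat) (n_ge2 : (2 <= n)%N) :
  exists delta D : vfield R n,
    [/\ complete delta, complete D & generates [set delta; D]].
Proof.
case: n n_ge2 => [|[|n]] // _.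
exists (diagonal_field R (fun i : 'I_n.+2 => 4 ^ i)%N), (overshear R n).
split; [exact: complete_diagonal_field|exact: complete_overshear|].
apply/seteqP; split=> [//|X _] L [LL Lsub].
have Lg : L (diagonal_field R (fun i : 'I_n.+2 => 4 ^ i)%N).
  by apply: Lsub; left.
have Ls : L (overshear R n) by apply: Lsub; right.
have iso := overshear_isolate LL Lg Ls.
have o1 : lift ord0 ord0 != ord0 :> 'I_n.+2 by [].
apply: (lie_full LL o1) => [j|i j ij|].
- rewrite -mpolyX0; apply: iso; last by rewrite quad_coeff0 pnatr_eq0.
  move=> k b _ /(congr1 (fun m : 'X_{1..n.+2} => m j)).
  rewrite !mnmDE !mnm1E mnm0E eqxx addn1.
  by case: eqP => // ->.
- apply: iso; last exact: quad_coeff1.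
  move=> k b _ /(congr1 (fun m : 'X_{1..n.+2} => m j)).
  rewrite !mnmDE !mnm1E eqxx (negPf ij) addn1.
  by case: eqP => // ->.
- have -> : 'X_ord0 ^+ 2 = 'X_[U_(ord0) + U_(ord0)] :> {mpoly R[i][n.+2]}.
    by rewrite mpolyXD expr2.
  apply: iso; last by rewrite quad_coeff2.
  move=> k b nz; rewrite -addmA [(_ + U_(k))%MM]addmC addmA => /addIm E.
  by apply/eqP; rewrite -(quad_coeff2 R) addmC -E.
Qed.
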